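(* Let $d\ge1$ and $k,n\in\mathbb N_0$. For $1\le l\le d$, \[ \mathcal H\,V_{n,k}^l\subseteq V_{n,k}^{l-1}. \]
   Context: $\Omega=(0,1)^d$, $[d]=\{1,\dots,d\}$, $\mathbb N_0=\{0,1,2,\dots\}$. For $I=\{i_1<\dots<i_l\}\subseteq[d]$ put $\mathrm dx_I=\mathrm dx_{i_1}\wedge\cdots\wedge\mathrm dx_{i_l}$. One-dimensional spaces. $\mathbb P_r(K)$: polynomials of degree at most $r$ on the interval $K$. $\mathcal T_m$: uniform partition of $(0,1)$ into $2^m$ cells. $S_m^{k+1}=\{v\in C^0([0,1]):v|_K\in\mathbb P_{k+1}(K)\ \forall K\in\mathcal T_m\}$, $Q_m^k=\{q\in L^2(0,1):q|_K\in\mathbb P_k(K)\ \forall K\in\mathcal T_m\}$. $Z_0^k=Q_0^k$, and for $m\ge1$, $Z_m^k$ is the $L^2(0,1)$-orthogonal complement of $Q_{m-1}^k$ in $Q_m^k$. One has $Z_m^k=\bigoplus_{K\in\mathcal T_{m-1}}Z_K^k$, where $Z_K^k$ consists of functions supported on $K$ that are polynomials of degree at most $k$ on each of the two halves of $K$ and are $L^2(K)$-orthogonal to $\mathbb P_k(K)$; let $\{\psi_{m,K,r}^k\}_{r=0}^k$ be an $L^2$-orthonormal basis of $Z_K^k$. For $K=[a_K,b_K]\in\mathcal T_{m-1}$ set $\theta_{m,K,r}^{k+1}(x)=\int_{a_K}^x\psi_{m,K,r}^k(s)\,\mathrm ds$ for $x\in K$ and $0$ for $x\notin K$. $Y_0^{k+1}=S_0^{k+1}$,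 and for $m\ge1$, $Y_m^{k+1}=\operatorname{span}\{\theta_{m,K,r}^{k+1}:K\in\mathcal T_{m-1},0\le r\le k\}$. Sparse spaces. $\mathcal M_n=\{\boldsymbol m\in\mathbb N_0^d:m_1+\dots+m_d\le n+d-1\}$, $W_{\boldsymbol m}^{I,k}=\big(\bigotimes_{i\in I}Z_{m_i}^k(x_i)\big)\otimes\big(\bigotimes_{j\notin I}Y_{m_j}^{k+1}(x_j)\big)$, and $V_{n,k}^l=\bigoplus_{|I|=l}\bigoplus_{\boldsymbol m\in\mathcal M_n}W_{\boldsymbol m}^{I,k}\,\mathrm dx_I$. Homotopy. For $q\in L^2(0,1)$ let $Aq(x)=\int_0^xq(t)\,\mathrm dt-\int_0^1\int_0^yq(t)\,\mathrm dt\,\mathrm dy$, and let $A_i$ be $A$ acting only in $x_i$. For $i\in[d]$, extended linearly to forms: $p_i(u_I\,\mathrm dx_I)=\big(\int_0^1u_I(x_1,\dots,t,\dots,x_d)\,\mathrm dt\big)\mathrm dx_I$ ($t$ in the $i$th slot) if $i\notin I$, and $p_i(u_I\,\mathrm dx_I)=0$ if $i\in I$; $h_i(u_I\,\mathrm dx_I)=0$ if $i\notin I$, and $h_i(u_I\,\mathrm dx_I)=(-1)^{r-1}(A_iu_I)\,\mathrm dx_{I\setminus\{i\}}$ if $i$ is the $r$th element of the ordered set $I$. $P_{<1}=\mathrm{id}$, $P_{<i}=p_1\cdots p_{i-1}$, and $\mathcal H=\sum_{i=1}^dP_{<i}h_i$. *)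

(* Defs.v *)
From HB Require Import structures.
From mathcomp Require Import all_boot all_order all_algebra.
From mathcomp Require Import all_classical all_reals all_analysis.

Set Implicit Arguments.
Unset Strict Implicit.
Unset Printing Implicit Defensive.

Import Order.TTheory GRing.Theory Num.Theory.
Import numFieldNormedType.Exports.

Local Open Scope classical_set_scope.
Local Open Scope ring_scope.

(** Elements of L^2 are represented by functions: Borel functions for the
    one-dimensional spaces [Q_space], [Z_space], [ZK_space], arbitrary functions for the spaces
    [W_space] and [V_space] in dimension [d]. Membership in these spaces only
    depends on the class of the function up to equality almost everywhere on
    (0,1), resp. (0,1)^d. The elements of [S_space] and [Y_space] are continuous functions
    and are constrained at every point of [0,1]. *)

Notation point R d := (d.-tuple (measurableTypeR R)).

Section tuple_cons_measure.
Context (R : realType) (d : nat).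
Variable m : {sigma_finite_measure set (point R d) -> \bar R}.

Definition cons_pair (xy : measurableTypeR R * point R d) : point R d.+1 :=
  [tuple of xy.1 :: xy.2].

Lemma measurable_cons_pair : measurable_fun [set: _] cons_pair.
Proof.
apply: measurable_cons; [exact: measurable_fst|exact: measurable_snd].
Qed.


Definition cons_measure : set (point R d.+1) -> \bar R :=
  pushforward (lebesgue_measure \x m)%E cons_pair.

Let cons_measure0 : cons_measure set0 = 0%E.
Proof. exact: (measure0 (lebesgue_measure \x m)%E). Qed.

Let cons_measure_ge0 A : (0 <= cons_measure A)%E.
Proof. exact: (measure_ge0 (lebesgue_measure \x m)%E). Qed.

Let cons_measure_sigma_additive : semi_sigma_additive cons_measure.
Proof.
move=> F mF tF mUF; rewrite /cons_measure /pushforward preimage_bigcup.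
have mpre A : measurable A -> measurable (cons_pair @^-1` A).
  by move=> mA; rewrite -[X in measurable X]setTI; exact: measurable_cons_pair.
apply: measure_semi_sigma_additive; first by move=> n; exact: mpre.
- apply/trivIsetP => /= i j _ _ ij; rewrite -preimage_setI.
  by move/trivIsetP : tF => /(_ _ _ _ _ ij) ->//; rewrite preimage_set0.
- by rewrite -preimage_bigcup; exact: mpre.
Qed.

HB.instance Definition _ := isMeasure.Build _ _ _ cons_measure
  cons_measure0 cons_measure_ge0 cons_measure_sigma_additive.

Let cons_measure_sigma_finite : sigma_finite setT cons_measure.
Proof.
have /sigma_finiteP[F [TF ndF Foo]] := sigma_finiteT (@lebesgue_measure R).
have /sigma_finiteP[G [TG ndG Goo]] := sigma_finiteT m.
pose uncons (x : point R d.+1) : measurableTypeR R * point R d :=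
  (thead x, [tuple of behead x]).
have consK : cancel cons_pair uncons.
  by move=> [x y]; rewrite /uncons theadE; congr pair; apply: val_inj.
have unconsK : cancel uncons cons_pair.
  by move=> x; rewrite [RHS]tuple_eta.
have muncons : measurable_fun [set: _] uncons.
  apply: measurable_fun_pair; first exact: measurable_tnth.
  exact: measurable_behead.
exists (fun n => uncons @^-1` (F n `*` G n)).
  apply/esym/seteqP; split=> // x _.
  have [n _ Fn] : (\bigcup_n F n) (uncons x).1 by rewrite -TF.
  have [p _ Gp] : (\bigcup_n G n) (uncons x).2 by rewrite -TG.
  exists (maxn n p) => //; split.
    by apply: subsetPset Fn; exact/ndF/leq_maxl.
  by apply: subsetPset Gp; exact/ndG/leq_maxr.
move=> n; have [mF Fn] := Foo n; have [mG Gn] := Goo n.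
have mFG : measurable (F n `*` G n) by exact: measurableX.
split; first by rewrite -[X in measurable X]setTI; exact: muncons.
rewrite /cons_measure /pushforward -comp_preimage.
rewrite (_ : uncons \o cons_pair = id); last by apply/funext => x /=.
rewrite preimage_id product_measure1E// lte_mul_pinfty// ge0_fin_numE//.
Qed.

HB.instance Definition _ := Measure_isSigmaFinite.Build _ _ _ cons_measure
  cons_measure_sigma_finite.

End tuple_cons_measure.

Fixpoint lebesgue_Rn (R : realType) (d : nat) :
    {sigma_finite_measure set (point R d) -> \bar R} :=
  match d with
  | 0 => @dirac _ (point R 0) [tuple] R
  | d'.+1 => cons_measure (lebesgue_Rn R d')
  end.

Definition unit_cube (R : realType) (d : nat) : set (point R d) :=
  [set x | forall i : 'I_d, 0 < (tnth x i : R) < 1].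

Section one_dimensional.
Context (R : realType).
Local Notation mu := (@lebesgue_measure R).
Implicit Types (q v : R -> R) (k m : nat).

Definition cell_left m (j : nat) : R := j%:R / 2 ^+ m.

(** The [j]-th cell of the uniform partition of (0,1) into [2^m] cells,
    meant for [j < 2^m]. *)
Definition cell m (j : nat) : set R := `[cell_left m j, cell_left m j.+1].

Definition in_L2 q := (q \_ `]0, 1[ : measurableTypeR R -> R) \in Lfun mu 2%:E.

Definition dot q v : R := \int[mu]_(x in `]0, 1[) (q x * v x).

Definition S_space m (r : nat) : set (R -> R) := [set v : R -> R |
  {within `[(0 : R), (1 : R)], continuous v} /\
  forall j, (j < 2 ^ m)%N -> exists2 p : {poly R}, (size p <= r.+1)%N &
    forall x, cell m j x -> v x = p.[x]].

Definition Q_space m k : set (R -> R) := [set q |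
  in_L2 q /\
  forall j, (j < 2 ^ m)%N -> exists2 p : {poly R}, (size p <= k.+1)%N &
    q = horner p %[ae mu in cell m j]].

Definition Z_space k m : set (R -> R) :=
  if m is m'.+1 then
    [set q | Q_space m'.+1 k q /\ forall g, Q_space m' k g -> dot q g = 0]
  else Q_space 0 k.

(** [ZK_space k m j] is the space Z_K^k for [K] the cell [j] of the partition
    into [2^m] cells; its halves are the cells [2j] and [2j+1] of the next
    partition. *)
Definition ZK_space k m (j : nat) : set (R -> R) := [set q |
  [/\ in_L2 q,
      q = cst 0 %[ae mu in `]0, 1[ `\` cell m j],
      forall b : bool, exists2 p : {poly R}, (size p <= k.+1)%N &
        q = horner p %[ae mu in cell m.+1 (j.*2 + b)] &
      forall p : {poly R}, (size p <= k.+1)%N ->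
        \int[mu]_(x in cell m j) (q x * p.[x]) = 0]].

Definition orthonormal_basis N (E : set (R -> R)) (psi : 'I_N -> R -> R) :=
  [/\ forall r, E (psi r),
      forall r s, dot (psi r) (psi s) = (r == s)%:R &
      forall q, E q -> exists c : 'I_N -> R,
        q = (fun x => \sum_(r < N) c r * psi r x) %[ae mu in `]0, 1[%classic]].

(** A family [psi] gives, for each cell [K] of the partition into [2^m] cells,
    the functions psi_{m+1,K,r}: the level of a wavelet is one more than that
    of the partition containing its cell. *)
Definition wavelets k := forall m : nat, 'I_(2 ^ m) -> 'I_k.+1 -> R -> R.

Definition theta k (psi : wavelets k) m (j : 'I_(2 ^ m)) (r : 'I_k.+1) (x : R)
    : R :=
  if x \in cell m j
  then \int[mu]_(s in `[cell_left m j, x]) psi m j r s else 0.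

Definition Y_space k (psi : wavelets k) m : set (R -> R) :=
  if m is m'.+1 then
    [set v | exists c : 'I_(2 ^ m') -> 'I_k.+1 -> R, forall x, 0 <= x <= 1 ->
      v x = \sum_j \sum_r c j r * theta psi j r x]
  else S_space 0 k.+1.

Definition antider q (x : R) : R :=
  \int[mu]_(t in `[0, x]) q t
  - \int[mu]_(y in `[0, 1]) \int[mu]_(t in `[0, y]) q t.

End one_dimensional.

(** The form [u] is the sum over [I] of [u I] dx_I. *)
Definition diff_form (R : realType) (d : nat) := {set 'I_d} -> point R d -> R.

Section forms.
Context (R : realType) (d : nat).
Local Notation mu := (@lebesgue_measure R).
Local Notation pt := (point R d).
Implicit Types (I J : {set 'I_d}) (u : diff_form R d) (x : pt).

Definition tensor (E : 'I_d -> set (R -> R)) : set (pt -> R) := [set w |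
  exists N (c : 'I_N -> R) (f : 'I_N -> 'I_d -> R -> R),
    (forall s i, E i (f s i)) /\
    w = (fun x => \sum_(s < N) c s * \prod_(i < d) f s i (tnth x i))
      %[ae lebesgue_Rn R d in @unit_cube R d]].

Definition W_space k (psi : wavelets R k) I (m : 'I_d -> nat) : set (pt -> R) :=
  tensor (fun i => if i \in I then Z_space k (m i) else Y_space psi (m i)).

Definition sparse_index n (m : 'I_d -> nat) :=
  (\sum_(i < d) m i <= n + d - 1)%N.

Definition V_space k (psi : wavelets R k) (n l : nat) :
    set (diff_form R d) := [set u | forall I,
  if #|I| == l then
    exists N (m : 'I_N -> 'I_d -> nat) (w : 'I_N -> pt -> R),
      (forall s, sparse_index n (m s) /\ W_space psi I (m s) (w s)) /\
      u I = (fun x => \sum_(s < N) w s x)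
        %[ae lebesgue_Rn R d in @unit_cube R d]
  else u I = cst 0 %[ae lebesgue_Rn R d in @unit_cube R d]].

Definition set_coord x (i : 'I_d) (t : R) : pt :=
  [tuple if j == i then t else tnth x j | j < d].

Definition p_ (i : 'I_d) u : diff_form R d := fun I x =>
  if i \in I then 0 else \int[mu]_(t in `[0, 1]) u I (set_coord x i t).

Definition A_ (i : 'I_d) (f : pt -> R) : pt -> R := fun x =>
  antider (fun t => f (set_coord x i t)) (tnth x i).

(** The exponent is the number of elements of [I] before [i], that is [r-1]
    when [i] is the [r]-th element of [I]. *)
Definition h_ (i : 'I_d) u : diff_form R d := fun J x =>
  \sum_(I : {set 'I_d} | (i \in I) && (I :\ i == J))
    (-1) ^+ #|[set j in I | (j < i)%N]| * A_ i (u I) x.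

Definition P_lt (i : 'I_d) : diff_form R d -> diff_form R d :=
  foldr (fun j F => p_ j \o F) id [seq j : 'I_d <- enum 'I_d | (j < i)%N].

Definition homotopy u : diff_form R d := fun J x =>
  \sum_(i < d) P_lt i (h_ i u) J x.

End forms.

(* Main.v *)
(** The operators [p_i] and [A_i] act on a tensor product through its [i]-th
    factor only, so everything reduces to two facts in one variable. For
    [q] in [Z_m] the function [A q] is the primitive of [q] vanishing at 0 minus
    a constant: the primitive lies in [Y_m], because on each cell it is a
    combination of the [theta]s (for m = 0 it is a polynomial), and the constant
    lies in [Y_0]. The mean of an element of [Y_m] is also a constant, hence in
    [Y_0]. Replacing a level [m_i] by 0 stays inside the sparse index set.

    The coefficients of forms are only known almost everywhere and need not be
    measurable, so the operators must be shown to respect equality almost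
    everywhere: by Fubini a null set has null slices along almost every line
    parallel to a coordinate axis, and the integral of the library does not see
    null sets even for nonmeasurable integrands. *)

Require Import Defs.
From mathcomp Require Import all_boot all_order all_algebra.
From mathcomp Require Import all_classical all_reals all_analysis.
From mathcomp Require Import measurable_realfun lra.

Set Implicit Arguments.
Unset Strict Implicit.
Unset Printing Implicit Defensive.

Import Order.TTheory GRing.Theory Num.Theory.
Import numFieldNormedType.Exports.

Local Open Scope classical_set_scope.
Local Open Scope ring_scope.

Local Notation Rn R d := (d.-tuple (measurableTypeR R)).

(** * Integration and equality almost everywhere *)

Section integral_ae_eq.
Context d (T : measurableType d) (R : realType).
Variable mu : {measure set T -> \bar R}.
Import HBNNSimple.

(* A simple function below [f] is cut to 0 on the null set where [f] and [g]
   differ; this does not change its integral and puts it below [g]. *)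
Lemma ge0_le_integral_ae_eq (f g : T -> \bar R) :
    (forall x, 0 <= f x)%E -> (forall x, 0 <= g x)%E ->
    f = g %[ae mu] ->
  (\int[mu]_x f x <= \int[mu]_x g x)%E.
Proof.
move=> f0 g0 [N [mN N0 fgN]].
rewrite ge0_integralTE// ge0_integralTE//.
apply: ge_ereal_sup => _ [h /= hf <-].
pose h' := proj_nnsfun h (measurableC mN).
apply: ereal_sup_ubound; exists h' => /=.
  move=> x; rewrite mindicE; case: (pselect (N x)) => Nx.
    by rewrite memNset ?mulr0//= => /(_ Nx).
  rewrite mem_set// mulr1 (_ : g x = f x)//.
  by apply: contrapT => gf; apply/Nx/fgN => /= /(_ I) /esym.
rewrite -!integralT_nnsfun; apply: ae_eq_integral => //.
- by apply/measurable_EFinP.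
- by apply/measurable_EFinP.
exists N; split => // x /= /not_implyP[_ hx]; apply: contrapT => Nx; apply: hx.
by rewrite mindicE mem_set// mulr1.
Qed.

Lemma integral_ae_eq (D : set T) (f g : T -> \bar R) :
  f = g %[ae mu in D] -> (\int[mu]_(x in D) f x = \int[mu]_(x in D) g x)%E.
Proof.
move=> fg; rewrite integral_mkcond [RHS]integral_mkcond.
have {fg} : f \_ D = g \_ D %[ae mu].
  apply: filterS fg => x fg _; rewrite !patchE; case: ifPn => // /set_mem.
  exact: fg.
move: (f \_ D) (g \_ D) => {}f {}g fg.
rewrite integralE [RHS]integralE; congr (_ - _)%E; apply/eqP; rewrite eq_le;
  apply/andP; split; apply: ge0_le_integral_ae_eq => //;
  by apply: filterS fg => x /(_ I) fg _; rewrite ?funeposE ?funenegE fg.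
Qed.

Lemma Rintegral_ae_eq (D : set T) (f g : T -> R) :
  f = g %[ae mu in D] -> \int[mu]_(x in D) f x = \int[mu]_(x in D) g x.
Proof.
move=> fg; congr fine; apply: integral_ae_eq.
by apply: filterS fg => x fg Dx; rewrite fg.
Qed.

Lemma integrable_sumr I (s : seq I) (D : set T) (f : I -> T -> R) :
    measurable D -> (forall i, mu.-integrable D (EFin \o f i)) ->
  mu.-integrable D (EFin \o (fun x => \sum_(i <- s) f i x)).
Proof.
move=> mD intf.
have -> : EFin \o (fun x => \sum_(i <- s) f i x) =
    (fun x => \sum_(i <- s) (f i x)%:E)%E.
  by apply/funext => x /=; rewrite sumEFin.
by apply: integrable_sum => // i _; exact: intf.
Qed.

Lemma Rintegral_sum I (s : seq I) (D : set T) (f : I -> T -> R) :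
    measurable D -> (forall i, mu.-integrable D (EFin \o f i)) ->
  \int[mu]_(x in D) (\sum_(i <- s) f i x) = \sum_(i <- s) \int[mu]_(x in D) f i x.
Proof.
move=> mD intf; elim: s => [|i s ih].
  rewrite big_nil; under eq_Rintegral do rewrite big_nil.
  by rewrite Rintegral_cst// mul0r.
rewrite big_cons -ih -RintegralD//; last exact: integrable_sumr.
by apply: eq_Rintegral => x _; rewrite big_cons.
Qed.

Lemma integrable_scaler (D : set T) (f : T -> R) (c : R) :
    measurable D -> mu.-integrable D (EFin \o f) ->
  mu.-integrable D (EFin \o (fun x => c * f x)).
Proof.
move=> mD intf; rewrite (_ : _ \o _ = fun x => c%:E * (EFin \o f) x)%E.
  exact: integrableZl.
by apply/funext => x /=; rewrite EFinM.
Qed.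

End integral_ae_eq.

Lemma measurable_neq0 d (T : measurableType d) (R : realType)
    (f : T -> \bar R) :
  measurable_fun setT f -> measurable [set x | f x <> 0%E].
Proof.
move=> mf; rewrite -[X in measurable X]setTI.
by apply: (mf measurableT (~` [set 0%E])); exact/measurableC/emeasurable_set1.
Qed.

(** * Slices of null sets *)

Lemma product_measure_eq0P d1 d2 (T1 : measurableType d1) (T2 : measurableType d2)
    (R : realType) (m1 : {measure set T1 -> \bar R})
    (m2 : {sigma_finite_measure set T2 -> \bar R}) (A : set (T1 * T2)) :
    measurable A ->
  (* The product measure integrates the measures of the sections, and a nonnegative measurable
     function has integral zero exactly when it vanishes almost everywhere. *)
  (m1 \x m2)%E A = 0%E <-> {ae m1, forall x, m2 (xsection A x) = 0%E}.
Proof.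
move=> mA; have mphi := measurable_fun_xsection m2 mA.
have -> : (m1 \x m2)%E A = (\int[m1]_(x in setT) `|(m2 \o xsection A) x|)%E.
  rewrite /product_measure1 /=; apply: eq_integral => x _.
  by rewrite gee0_abs.
split=> [/(ae_eq_integral_abs m1 measurableT mphi)|] H.
  by apply: filterS H => x /(_ I).
by apply/(ae_eq_integral_abs m1 measurableT mphi); apply: filterS H => x + _.
Qed.

Section slices.
Context (R : realType).
Local Notation mu := (@lebesgue_measure R).

Lemma set_coord_cons0 d (a t : R) (y : Rn R d) :
  set_coord (cons_pair (a, y)) ord0 t = cons_pair (t, y).
Proof.
apply/eq_from_tnth => j; rewrite tnth_mktuple.
case: (unliftP ord0 j) => [j' ->|->]; rewrite ?eqxx ?tnth0//=.
by rewrite !tnthS.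
Qed.

Lemma set_coord_consS d (a t : R) (y : Rn R d) (i : 'I_d) :
  set_coord (cons_pair (a, y)) (lift ord0 i) t = cons_pair (a, set_coord y i t).
Proof.
apply/eq_from_tnth => j; rewrite tnth_mktuple.
case: (unliftP ord0 j) => [j' ->|->]; last by rewrite !tnth0.
by rewrite !tnthS tnth_mktuple (inj_eq lift_inj).
Qed.

Lemma measurable_set_coord d (i : 'I_d) :
  measurable_fun [set: Rn R d * measurableTypeR R]
    (fun xt => set_coord xt.1 i xt.2 : Rn R d).
Proof.
apply/measurable_fun_tnthP => j.
have [->|ji] := eqVneq j i.
  rewrite (_ : _ \o _ = snd)//.
  by apply/funext => -[x t] /=; rewrite tnth_mktuple eqxx.
rewrite (_ : _ \o _ = (@tnth _ _ ^~ j) \o fst).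
  by apply: measurableT_comp => //; exact: measurable_tnth.
by apply/funext => -[x t] /=; rewrite tnth_mktuple (negbTE ji).
Qed.

Lemma measurable_slice_neq0 d (i : 'I_d) (N : set (Rn R d)) : measurable N ->
  measurable [set x : Rn R d | mu [set t | N (set_coord x i t)] <> 0%E].
Proof.
move=> mN.
pose M := (fun xt : Rn R d * measurableTypeR R =>
  set_coord xt.1 i xt.2 : Rn R d) @^-1` N.
have mM : measurable M.
  by rewrite -[X in measurable X]setTI; exact: measurable_set_coord.
rewrite (_ : mkset _ = [set x | (mu \o xsection M) x <> 0%E]).
  exact: measurable_neq0 (measurable_fun_xsection mu mM).
by apply/seteqP; split=> x /=; congr (_ <> _); congr (mu _); apply/seteqP;
  split=> t; rewrite /xsection/= inE.
Qed.

(** Induction on [d], splitting off the first coordinate. If [i] is a later coordinate, almost every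
    section of [N] at a first coordinate [a] is null, and the induction hypothesis applies inside
    that section. If [i] is the first coordinate, the exceptional set is a cylinder, whose base is
    null by Fubini in the other order. *)
Lemma slice_null d (i : 'I_d) (N : set (Rn R d)) :
    measurable N -> lebesgue_Rn R d N = 0%E ->
  lebesgue_Rn R d [set x | mu [set t | N (set_coord x i t)] <> 0%E] = 0%E.
Proof.
elim: d i N => [[]//|d ih] i N mN N0.
have mpre A : measurable A -> measurable (@cons_pair R d @^-1` A).
  by move=> mA; rewrite -[X in measurable X]setTI; exact: measurable_cons_pair.
have mS := measurable_slice_neq0 i mN.
set S := mkset _ in mS *.
(* In dimension [d.+1] the measure is by definition the image of a product measure under
   [cons_pair]. *)
change ((mu \x lebesgue_Rn R d)%E (@cons_pair R d @^-1` N) = 0%E) in N0.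
change ((mu \x lebesgue_Rn R d)%E (@cons_pair R d @^-1` S) = 0%E).
have mN' := mpre _ mN.
case: (unliftP ord0 i) => [j ij|i0].
  apply/product_measure_eq0P; first exact: mpre.
  move/(product_measure_eq0P _ _ mN') : N0.
  apply: filterS => a Na0.
  have := ih j _ (measurable_xsection a mN') Na0.
  congr (lebesgue_Rn R d _ = _); apply/seteqP; split => y;
    rewrite /S /xsection /= inE/= ij; apply: contra_not => <-;
    by congr (mu _); apply/seteqP; split => t /=; rewrite set_coord_consS ?inE.
pose S' := [set y | mu (ysection (@cons_pair R d @^-1` N) y) <> 0%E].
have mS' : measurable S'.
  exact: measurable_neq0 (measurable_fun_ysection mu mN').
(* Overwriting coordinate 0 forgets [a], so membership in [S] depends on [y] alone. *)
have -> : @cons_pair R d @^-1` S = setT `*` S'.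
  have SE a y : S (cons_pair (a, y)) = S' y.
    rewrite /S /S' /= i0; congr (_ <> _); congr (mu _).
    by apply/seteqP; split => t; rewrite /ysection /= inE /= set_coord_cons0.
  by apply/seteqP; split=> -[a y]; rewrite /preimage /= SE => // -[].
rewrite product_measure1E//.
(* The first factor has infinite measure; the convention that infinity times 0 is 0 applies. *)
suff -> : lebesgue_Rn R d S' = 0%E by rewrite mule0.
(* Both orders of integration give the same measure, by uniqueness on rectangles; the second order
   exposes the sections at fixed [y]. *)
have : (mu \x^ lebesgue_Rn R d)%E (@cons_pair R d @^-1` N) = 0%E.
  rewrite -N0; apply/esym/product_measure_unique => // A B mA mB.
  exact: product_measure2E.
move=> N0'.
have mpsi := measurable_fun_ysection mu mN'.
have : (\int[lebesgue_Rn R d]_(y in setT)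
    `|(mu \o ysection (@cons_pair R d @^-1` N)) y| = 0)%E.
  rewrite -N0'; apply: eq_integral => y _.
  by rewrite gee0_abs.
move=> /(ae_eq_integral_abs _ measurableT mpsi) H.
apply/negligibleP => //; apply: negligibleS H => y /= Sy.
by move=> /(_ I).
Qed.

Lemma ae_slice d (i : 'I_d) (P : Rn R d -> Prop) :
    {ae lebesgue_Rn R d, forall x, P x} ->
  {ae lebesgue_Rn R d, forall x, {ae mu, forall t, P (set_coord x i t)}}.
Proof.
move=> [N [mN N0 PN]].
exists [set x : Rn R d | mu [set t | N (set_coord x i t)] <> 0%E]; split.
- exact: measurable_slice_neq0.
- exact: slice_null.
move=> x /= nP Nx; apply: nP; exists [set t | N (set_coord x i t)]; split => //.
- rewrite -[X in measurable X]setTI.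
  have := measurableT_comp (@measurable_set_coord d i) (pair1_measurable x).
  exact.
- by move=> t /= nPt; exact: PN.
Qed.

End slices.

Section ae_implication.
Context d (T : measurableType d) (R : realType).
Variable mu : {measure set T -> \bar R}.

Lemma ae_imply (P Q : T -> Prop) :
  {ae mu, forall x, P x} -> (forall x, P x -> Q x) -> {ae mu, forall x, Q x}.
Proof. by move=> aP PQ; apply: filterS aP. Qed.

Lemma ae_imply2 (P Q S : T -> Prop) :
    {ae mu, forall x, P x} -> {ae mu, forall x, Q x} ->
  (forall x, P x -> Q x -> S x) -> {ae mu, forall x, S x}.
Proof. by move=> aP aQ PQS; apply: filterS2 aP aQ. Qed.

Lemma ae_imply3 (P Q S U : T -> Prop) :
    {ae mu, forall x, P x} -> {ae mu, forall x, Q x} ->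
    {ae mu, forall x, S x} ->
  (forall x, P x -> Q x -> S x -> U x) -> {ae mu, forall x, U x}.
Proof. by move=> aP aQ aS PQSU; apply: filterS3 aP aQ aS. Qed.

End ae_implication.

(** * Primitives and the operator A in one variable *)

Section primitives.
Context (R : realType).
Local Notation mu := (@lebesgue_measure R).
Implicit Types (q r : R -> R).

Lemma ae_neq (a : R) : {ae mu, forall t, t <> a}.
Proof.
exists [set a]; split => //; first exact: lebesgue_measure_set1.
by move=> t /= /contrapT.
Qed.

(** Bridges the open interval, on which classes of functions are compared, and the closed one, over
    which [antider] and [p_] integrate. *)
Lemma ae_eq_itv_oo_cc q r :
  q = r %[ae mu in (`]0, 1[%classic : set R)] ->
  q = r %[ae mu in (`[0, 1]%classic : set R)].
Proof.
move=> H; apply: (ae_imply3 (ae_neq 0) (ae_neq 1) H) => t t0 t1 qr.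
rewrite /= in_itv/= !le_eqVlt => /andP[/predU1P[/esym//|gt0] /predU1P[//|lt1]].
by apply: qr; rewrite /= in_itv/= gt0.
Qed.

Lemma subset_itv_0x (x : R) : 0 <= x <= 1 -> `[0, x]%classic `<=` `[0, 1]%classic.
Proof.
move=> /andP[_ x1] t /=; rewrite !in_itv/= => /andP[-> /=].
by move=> /le_trans; exact.
Qed.

Lemma antider_ae_eq q r (x : R) : 0 <= x <= 1 ->
    q = r %[ae mu in (`[0, 1]%classic : set R)] ->
  antider q x = antider r x.
Proof.
move=> x01 qr.
have prim y : 0 <= y <= 1 ->
    \int[mu]_(t in `[0, y]) q t = \int[mu]_(t in `[0, y]) r t.
  move=> y01; apply: Rintegral_ae_eq; apply: (ae_imply qr) => t {}qr.
  by move=> /(subset_itv_0x y01); exact: qr.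
congr (_ - _); first exact: prim.
by apply: eq_Rintegral => y; rewrite inE/= in_itv/=; exact: prim.
Qed.

Lemma integrable_primitive q : mu.-integrable `[0, 1] (EFin \o q) ->
  mu.-integrable `[0, 1] (EFin \o (fun x => \int[mu]_(t in `[0, x]) q t)).
Proof.
move=> iq; apply: continuous_compact_integrable; first exact: segment_compact.
exact: parameterized_integral_continuous.
Qed.

Lemma antider_sum I (s : seq I) (c : I -> R) (q : I -> R -> R) (x : R) :
    0 <= x <= 1 -> (forall i, mu.-integrable `[0, 1] (EFin \o q i)) ->
  antider (fun t => \sum_(i <- s) c i * q i t) x
  = \sum_(i <- s) c i * antider (q i) x.
Proof.
move=> x01 iq.
have iqS y i : 0 <= y <= 1 -> mu.-integrable `[0, y] (EFin \o q i).
  by move=> y01; apply: integrableS (iq i) => //; exact: subset_itv_0x.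
have prim y : 0 <= y <= 1 ->
    \int[mu]_(t in `[0, y]) (\sum_(i <- s) c i * q i t) =
    \sum_(i <- s) c i * \int[mu]_(t in `[0, y]) q i t.
  move=> y01; rewrite Rintegral_sum//; last first.
    by move=> i; apply: integrable_scaler => //; exact: iqS.
  by apply: eq_bigr => i _; rewrite RintegralZl//; exact: iqS.
rewrite /antider prim//.
under [X in _ - X]eq_Rintegral => y.
  by rewrite inE/= in_itv/= => y01; rewrite prim//; over.
rewrite Rintegral_sum//; last first.
  by move=> i; apply: integrable_scaler => //; exact: integrable_primitive.
rewrite -sumrB; apply: eq_bigr => i _.
by rewrite RintegralZl//; [rewrite mulrBr|exact: integrable_primitive].
Qed.

End primitives.

(** * Compatibility of the coordinate operators with equality almost everywhere on the cube *)

Section ae_cube.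
Context (R : realType) (d : nat).
Local Notation mu := (@lebesgue_measure R).
Implicit Types (f g : Rn R d -> R).

Lemma unit_cube_set_coord (x : Rn R d) (i : 'I_d) (t : R) :
  unit_cube x -> 0 < t < 1 -> unit_cube (set_coord x i t).
Proof. by move=> x01 t01 j; rewrite tnth_mktuple; case: eqP. Qed.

Lemma slice_ae_eq f g (i : 'I_d) :
    f = g %[ae lebesgue_Rn R d in @unit_cube R d] ->
  {ae lebesgue_Rn R d, forall x, unit_cube x ->
    f \o set_coord x i = g \o set_coord x i %[ae mu in (`[0, 1]%classic : set R)]}.
Proof.
move=> /(ae_slice i); apply: filterS => x fg x01.
apply: ae_eq_itv_oo_cc; apply: (ae_imply fg) => t {}fg t01 /=.
by apply: fg; apply: unit_cube_set_coord => //; move: t01; rewrite /= in_itv.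
Qed.

Lemma int_coord_ae_eq f g (i : 'I_d) :
    f = g %[ae lebesgue_Rn R d in @unit_cube R d] ->
  (fun x => \int[mu]_(t in `[0, 1]) f (set_coord x i t)) =
  (fun x => \int[mu]_(t in `[0, 1]) g (set_coord x i t))
    %[ae lebesgue_Rn R d in @unit_cube R d].
Proof.
by move=> /(slice_ae_eq i); apply: filterS => x + x01 => /(_ x01);
  exact: Rintegral_ae_eq.
Qed.

Lemma A_ae_eq f g (i : 'I_d) :
    f = g %[ae lebesgue_Rn R d in @unit_cube R d] ->
  A_ i f = A_ i g %[ae lebesgue_Rn R d in @unit_cube R d].
Proof.
move=> /(slice_ae_eq i); apply: filterS => x + x01 => /(_ x01) fg.
by apply: antider_ae_eq => //; have /andP[/ltW -> /ltW ->] := x01 i.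
Qed.

End ae_cube.

(** * One-dimensional spaces *)

Lemma Lfun2P d (T : measurableType d) (R : realType)
    (mu : {measure set T -> \bar R}) (f : T -> R) :
  f \in Lfun mu 2%:E <->
  measurable_fun setT f /\ mu.-integrable setT (EFin \o (fun x => f x ^+ 2)).
Proof.
split=> [f2|[mf sqrf]].
  split; last exact: Lfun2_integrable_sqr.
  by move: f2; rewrite inE => /andP[]; rewrite inE.
rewrite inE; apply/andP; split; rewrite inE//=.
rewrite /finite_norm unlock poweR_lty//.
move/integrableP : sqrf => [_]; apply: le_lt_trans.
rewrite le_eqVlt; apply/orP; left; apply/eqP; apply: eq_integral => x _ /=.
by rewrite powR_mulrn// normrX.
Qed.

Section one_dimension.
Context (R : realType).
Local Notation mu := (@lebesgue_measure R).
Implicit Types (q v : R -> R) (p : {poly R}) (k m : nat).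

Lemma integrable_itv_oo q : mu.-integrable `[0, 1] (EFin \o q) ->
  mu.-integrable `]0, 1[ (EFin \o q).
Proof. by move=> iq; apply: integrableS iq => //; exact: subset_itv_oo_cc. Qed.

Lemma in_L2P q : in_L2 q <->
  measurable_fun (`]0, 1[%classic : set (measurableTypeR R)) q /\
  mu.-integrable `]0, 1[ (EFin \o (fun x => q x ^+ 2)).
Proof.
rewrite /in_L2 Lfun2P -measurable_restrictT//.
rewrite (@integrable_mkcond _ _ _ mu
  (`]0, 1[%classic : set (measurableTypeR R)))// restrict_EFin.
rewrite (_ : (fun x => (q \_ _) x ^+ 2) = (fun x => q x ^+ 2) \_ `]0, 1[)//.
by apply/funext => x; rewrite !patchE; case: ifP => // _; rewrite expr0n.
Qed.

(** On a bounded interval [q] is dominated by the integrable function 1 + q^2. *)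
Lemma in_L2_integrable q : in_L2 q -> mu.-integrable `[0, 1] (EFin \o q).
Proof.
move=> /in_L2P[mq iq2].
have i1 : mu.-integrable `]0, 1[ (EFin \o (fun x => 1 + q x ^+ 2)).
  rewrite (_ : _ \o _ = ((EFin \o cst 1%R) \+ (EFin \o (fun x => q x ^+ 2)%R))%E)//.
  apply: integrableD => //; apply: integrable_itv_oo.
  apply: continuous_compact_integrable; first exact: segment_compact.
  by apply: continuous_subspaceT => x; exact: cvg_cst.
have /integrableP[_ ioo] : mu.-integrable `]0, 1[ (EFin \o q).
  apply: le_integrable i1 => //; first exact/measurable_EFinP.
  move=> x _ /=; rewrite lee_fin [leRHS]ger0_norm ?addr_ge0 ?sqr_ge0//.
  (* Expanding this square gives |q| <= q^2 + 1/4. *)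
  have := sqr_ge0 (`|q x| - 2^-1); rewrite sqrrB real_normK ?num_real//.
  move: (`|q x|) (q x ^+ 2) => y z; rewrite expr2; lra.
(* Adding the two endpoints affects neither measurability nor the integral. *)
have mq' : measurable_fun (`[0, 1]%classic : set (measurableTypeR R)) (EFin \o q).
  by apply/measurable_EFinP;
    exact: (measurable_fun_itv_cc (b0 := false) (b1 := true)).
apply/integrableP; split => //; move: ioo.
rewrite -(@integral_itv_bndoo _ 0 1 _ true false)//.
by apply: measurableT_comp => //; exact/measurable_EFinP.
Qed.

Lemma in_L2_restrict (K : set R) q :
  measurable (K : set (measurableTypeR R)) -> in_L2 q -> in_L2 (q \_ K).
Proof.
move=> mK /in_L2P[mq iq]; apply/in_L2P.
have mqK : measurable_fun (`]0, 1[%classic : set (measurableTypeR R)) (q \_ K).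
  apply/measurable_restrict => //; apply: measurable_funS mq => //.
split=> //; apply: le_integrable iq => //.
  by apply/measurable_EFinP; exact: measurable_funX.
move=> x _ /=; rewrite !lee_fin patchE; case: ifP => // _.
by rewrite expr0n normr0.
Qed.

Lemma in_L2_horner p : in_L2 (horner p).
Proof.
apply/in_L2P; split; first exact: measurable_poly.
apply: integrable_itv_oo.
apply: continuous_compact_integrable; first exact: segment_compact.
apply: continuous_subspaceT => x.
rewrite (_ : (fun x => p.[x] ^+ 2) = horner (p ^+ 2)).
  exact: continuous_horner.
by apply/funext => y; rewrite horner_exp.
Qed.

Lemma integrable_horner p : mu.-integrable `[0, 1] (EFin \o horner p).
Proof. exact/in_L2_integrable/in_L2_horner. Qed.

Lemma polynomial_primitive p : exists2 P : {poly R}, (size P <= (size p).+1)%N &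
  forall x, 0 <= x -> \int[mu]_(t in `[0, x]) p.[t] = P.[x].
Proof.
(* The shifted index is harmless at [i = 0]: division by 0 yields 0, which makes P vanish at 0. *)
pose P := \poly_(i < (size p).+1) (p`_i.-1 / i%:R).
have P0 : P.[0] = 0.
  by rewrite horner_coef0 coef_poly /= invr0 mulr0.
have dP : P^`() = p.
  apply/polyP => i; rewrite coef_deriv coef_poly ltnS.
  case: ltnP => [ip|pi]; last by rewrite mul0rn nth_default.
  by rewrite -[LHS]mulr_natr divfK// pnatr_eq0.
exists P; first exact: size_poly.
(* The fundamental theorem of calculus requires a nondegenerate interval, so x = 0 is treated
   apart. *)
move=> x; rewrite le_eqVlt => /predU1P[<-|x0].
  by rewrite set_itv1 Rintegral_set1 P0.
rewrite /Rintegral (@continuous_FTC2 _ (horner p) (horner P))//=.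
- by rewrite P0 subr0.
- by apply: continuous_subspaceT; exact: continuous_horner.
- split.
  + by move=> y _; exact: derivable_horner.
  + by apply: cvg_at_right_filter; exact: continuous_horner.
  + by apply: cvg_at_left_filter; exact: continuous_horner.
- by move=> y _; rewrite -derivE dP.
Qed.

End one_dimension.

(** * Dyadic cells and localization of the spaces Z_m *)

Section cells.
Context (R : realType).
Local Notation mu := (@lebesgue_measure R).
Implicit Types (q v : R -> R) (p : {poly R}) (k m : nat).

Let exp2_gt0 m : 0 < 2 ^+ m :> R. Proof. by rewrite exprn_gt0. Qed.

Lemma cellE m j (x : R) : cell m j x <-> (j%:R <= x * 2 ^+ m <= j.+1%:R).
Proof.
by rewrite /cell /cell_left /= in_itv/= ler_pdivrMr// ler_pdivlMr.
Qed.

Lemma measurable_cell m j : measurable (cell m j : set (measurableTypeR R)).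
Proof. exact: measurable_itv. Qed.

Lemma cell_sub01 m j : (j < 2 ^ m)%N -> @cell R m j `<=` `[0, 1]%classic.
Proof.
move=> jm x /cellE /andP[jx xj]; rewrite /= in_itv/=; apply/andP; split.
  by rewrite -(pmulr_lge0 _ (exp2_gt0 m)); apply: le_trans jx.
rewrite -(ler_pM2r (exp2_gt0 m)) mul1r (le_trans xj)// -natrX ler_nat.
exact: jm.
Qed.

Lemma cell00 : @cell R 0 0 = `[0, 1]%classic.
Proof. by rewrite /cell /cell_left expr0 !divr1. Qed.

Lemma cell_half m j (b : bool) : @cell R m.+1 (j.*2 + b) `<=` cell m j.
Proof.
move=> x /cellE /andP[jx xj]; apply/cellE.
move: jx xj; rewrite exprS mulrCA -addnS -(addn1 b) -muln2 !natrD !natrM.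
rewrite -[j.+1]addn1 natrD.
move: (x * _) => y.
have : 0 <= (b%:R : R) <= 1 by case: b; rewrite ?ler01 ?lexx.
move: (b%:R : R) (j%:R : R) => c i /andP[c0 c1] h1 h2; apply/andP; split; lra.
Qed.

(* Off the nodes of the partition the cells are pairwise disjoint. *)
Lemma ae_cell m : {ae mu, forall x : R, 0 < x < 1 ->
  exists2 i, (i < 2 ^ m)%N & forall j, (x \in @cell R m j) = (j == i)}.
Proof.
have := ae_foralln (fun j => ae_neq (@cell_left R m j)).
move=> H; apply: (ae_imply H) => x {}H /andP[x0 x1].
have y0 : 0 <= x * 2 ^+ m by rewrite mulr_ge0// ltW.
(* The cell containing x is numbered by the integer part of x 2^m. *)
exists (Num.truncn (x * 2 ^+ m)).
  rewrite -(ltr_nat R) natrX.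
  apply: le_lt_trans (_ : x * 2 ^+ m < _); last by rewrite gtr_pMl.
  by have /andP[] := truncn_itv y0.
have nj j : x * 2 ^+ m != j%:R.
  by apply/eqP => xj; apply: (H j); rewrite /cell_left -xj mulfK.
move=> j; apply/idP/eqP => [|->].
  rewrite inE => /cellE /andP[].
  rewrite !le_eqVlt eq_sym !(negbTE (nj _))/= => jx xj; apply/esym.
  by apply: truncn_def; rewrite (ltW jx) xj.
rewrite inE; apply/cellE; have /andP[-> /ltW ->] := truncn_itv y0.
by [].
Qed.

Lemma ae_cell01 m : {ae mu, forall x : R, 0 <= x <= 1 ->
  exists2 i, (i < 2 ^ m)%N & forall j, (x \in @cell R m j) = (j == i)}.
Proof.
apply: (ae_imply3 (ae_neq 0) (ae_neq 1) (ae_cell m)) => x x0 x1 H.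
by rewrite !le_eqVlt => /andP[/predU1P[/esym//|x0'] /predU1P[//|x1']];
  apply: H; rewrite x0'.
Qed.

(** A polynomial cut off to one cell still belongs to the coarser space Q_m, so global orthogonality
    to Q_m already contains orthogonality on each cell. *)
Lemma Z_space_ZK k m q (j : 'I_(2 ^ m)) :
  Z_space k m.+1 q -> ZK_space k m j (q \_ (cell m j)).
Proof.
move=> [[qL2 qpoly] qorth]; split.
- by apply: in_L2_restrict => //; exact: measurable_cell.
- by apply: aeW => x [_ xj]; rewrite patchE memNset.
- move=> b.
  have jb : (j.*2 + b < 2 ^ m.+1)%N.
    by rewrite expnS mul2n -ltn_half_double addnC half_bit_double.
  have [p sp qp] := qpoly _ jb; exists p => //.
  apply: (ae_imply qp) => x {}qp xj; rewrite patchE mem_set; first exact: qp.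
  exact: cell_half xj.
- move=> p sp.
  have gQ : Q_space m k (horner p \_ (cell m j)).
    split.
      by apply: in_L2_restrict; [exact: measurable_cell|exact: in_L2_horner].
    move=> i im; have [<-|ij] := eqVneq (nat_of_ord j) i.
      by exists p => //; apply: aeW => x xj; rewrite patchE mem_set.
    (* On any other cell the truncated polynomial vanishes, except possibly at a node shared with
       cell [j]; hence only almost everywhere. *)
    exists 0; first by rewrite size_poly0.
    apply: (ae_imply (ae_cell01 m)) => x H xi.
    have := cell_sub01 im xi; rewrite /= in_itv/= => /H[i0 _ H0].
    rewrite horner0 patchE H0; move/mem_set : xi; rewrite H0 => /eqP <-.
    by rewrite (negbTE ij).
  apply: etrans (qorth _ gQ); rewrite /dot.
  transitivity (\int[mu]_(x in cell m j) (q x * p.[x])).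
    by apply: eq_Rintegral => x xj; rewrite patchE xj.
  rewrite [RHS](_ : _ = \int[mu]_(x in `]0, 1[)
      ((fun x => q x * p.[x]) \_ (cell m j)) x); last first.
    apply: eq_Rintegral => x _; rewrite !patchE; case: ifP => //.
    by rewrite mulr0.
  rewrite [LHS]Rintegral_mkcond [RHS]Rintegral_mkcond.
  (* Both integrands are now extended by zero to the line; they can differ only at 0 and 1. *)
  apply: Rintegral_ae_eq.
  apply: (ae_imply2 (ae_neq 0) (ae_neq 1)) => x x0 x1 _.
  rewrite !patchE; case: ifPn => xj; last by case: ifP.
  rewrite ifT// inE/= in_itv/=.
  have := cell_sub01 (ltn_ord j) (set_mem xj).
  rewrite /= in_itv/= !le_eqVlt => /andP[/predU1P[/esym//|->] /predU1P[//|->]].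
  by [].
Qed.

(* The left-hand side is [theta]. To the right of the cell the primitive of [q]
   vanishes since [q] is orthogonal to the constant 1 on the cell. *)
Lemma ZK_primitive k m (j : 'I_(2 ^ m)) q (x : R) : ZK_space k m j q ->
    0 <= x <= 1 ->
  (if x \in cell m j then \int[mu]_(s in `[cell_left R m j, x]) q s else 0)
  = \int[mu]_(s in `[0, x]) q s.
Proof.
move=> [_ q0 _ qorth] x01.
have jm := ltn_ord j; have sub := cell_sub01 jm.
(* Since q vanishes almost everywhere off the cell, only the part of [0, x] in the cell counts. The
   position of x (inside, left or right of the cell) is then distinguished. *)
have -> : \int[mu]_(s in `[0, x]) q s = \int[mu]_(s in `[0, x] `&` cell m j) q s.
  rewrite Rintegral_mkcondr; apply: Rintegral_ae_eq.
  apply: (ae_imply3 (ae_neq 0) (ae_neq 1) q0) => s s0 s1 q0s sx.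
  rewrite patchE; case: ifPn => // /negP sj; apply: q0s; split.
    have := subset_itv_0x x01 sx; rewrite /= !in_itv/= !le_eqVlt.
    by move=> /andP[/predU1P[/esym//|->] /predU1P[//|->]].
  by move=> /mem_set.
have a0 : 0 <= cell_left R m j by rewrite divr_ge0// ltW.
have [xj|xj] := boolP (x \in cell m j).
  congr Rintegral; apply/seteqP; split => s; move/set_mem: xj;
    rewrite /cell /= !in_itv/= => /andP[ax xb].
    by move=> /andP[as_ sx]; rewrite (le_trans a0 as_) as_ sx (le_trans sx xb).
  by move=> [/andP[_ ->] /andP[->]].
have [xa|ax] := ltP x (cell_left R m j).
  rewrite (_ : _ `&` _ = set0) ?Rintegral_set0//; apply/seteqP; split=> // s.
  rewrite /cell /= !in_itv/= => -[/andP[_ sx] /andP[/le_trans/(_ sx)]].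
  by rewrite leNgt xa.
rewrite setIidr; last first.
  move=> s sj; have := sub _ sj; move: sj; rewrite /cell /= !in_itv/=.
  move=> /andP[_ sb] /andP[-> _] /=; rewrite (le_trans sb)// leNgt.
  apply: contra xj => xb; rewrite inE /cell/= in_itv/= ax ltW//.
have := qorth 1; rewrite size_poly1 => /(_ isT) <-.
by apply: eq_Rintegral => s _; rewrite hornerC mulr1.
Qed.

End cells.

(** * The spaces Y_m and the action of A on Z_m *)

Section hierarchical_spaces.
Context (R : realType) (k : nat) (psi : wavelets R k).
Local Notation mu := (@lebesgue_measure R).
Implicit Types (q v : R -> R) (m : nat).

Lemma Z_integrable m q : Z_space k m q -> mu.-integrable `[0, 1] (EFin \o q).
Proof. by case: m => [[]|m [[]]] /in_L2_integrable. Qed.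

Lemma Y0_cst (c : R) : Y_space psi 0 (cst c).
Proof.
split; first by apply: continuous_subspaceT => x; exact: cvg_cst.
move=> j _; exists c%:P; last by move=> x _; rewrite hornerC.
by rewrite (leq_trans (size_polyC_leq1 _)).
Qed.

Lemma Y0_horner (p : {poly R}) : (size p <= k.+2)%N ->
  Y_space psi 0 (horner p).
Proof.
move=> sp; split; last by move=> j _; exists p.
by apply: continuous_subspaceT; exact: continuous_horner.
Qed.

Hypothesis hpsi : forall (m : nat) (j : 'I_(2 ^ m)),
  orthonormal_basis (@ZK_space R k m j) (@psi m j).

Lemma psi_integrable m (j : 'I_(2 ^ m)) r :
  mu.-integrable `[0, 1] (EFin \o psi j r).
Proof. by have [/(_ r)[? _ _ _] _ _] := hpsi j; exact: in_L2_integrable. Qed.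

(** Trades the cellwise definition for one primitive from 0, common to all cells, so that sums over
    cells can be integrated term by term. *)
Lemma thetaE m (j : 'I_(2 ^ m)) r (x : R) : 0 <= x <= 1 ->
  theta psi j r x = \int[mu]_(s in `[0, x]) psi j r s.
Proof.
by move=> x01; have [/(_ r) psiZ _ _] := hpsi j; exact: (ZK_primitive psiZ).
Qed.

Lemma Y_integrable m v : Y_space psi m v -> mu.-integrable `[0, 1] (EFin \o v).
Proof.
case: m => [[_ /(_ 0%N isT)[p _]]|m [c vE]].
  rewrite cell00 => vp; apply: eq_integrable (integrable_horner p) => //.
  by move=> x /set_mem x01 /=; rewrite vp.
have : mu.-integrable `[0, 1] (EFin \o (fun x => \sum_j \sum_r
    c j r * \int[mu]_(s in `[0, x]) psi j r s)).
  apply: integrable_sumr => // j; apply: integrable_sumr => // r.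
  apply: integrable_scaler => //; apply: integrable_primitive.
  exact: psi_integrable.
apply: eq_integrable => // x; rewrite inE/= in_itv/= => x01.
rewrite vE//; congr (_ %:E); apply: eq_bigr => j _; apply: eq_bigr => r _.
by rewrite thetaE.
Qed.

(** Almost everywhere q is the sum of its restrictions to the cells. Each restriction lies in Z_K
    and expands in the wavelets of K; integrating the expansion from 0 turns every [psi] into a
    [theta] with the same coefficient. *)
Lemma Z_primitive m q : Z_space k m.+1 q ->
  Y_space psi m.+1 (fun x => \int[mu]_(t in `[0, x]) q t).
Proof.
move=> qZ; have qint := Z_integrable qZ.
have qjZ j := Z_space_ZK j qZ.
have /choice[c cE] : forall j : 'I_(2 ^ m), exists c : 'I_k.+1 -> R,
    q \_ (cell m j) = (fun x => \sum_(r < k.+1) c r * psi j r x)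
      %[ae mu in `]0, 1[%classic].
  by move=> j; have [_ _] := hpsi j; apply; exact: qjZ.
exists c => x x01.
have sub := subset_itv_0x x01.
(* Off the nodes exactly one summand can be nonzero, that of the cell containing t. *)
transitivity (\int[mu]_(t in `[0, x])
    (\sum_(j < 2 ^ m) (q \_ (cell m j)) t)).
  apply: Rintegral_ae_eq; apply: (ae_imply (ae_cell01 R m)) => t H /sub.
  rewrite /= in_itv/= => /H[i im Hi].
  rewrite (bigD1 (Ordinal im))//= patchE Hi eqxx big1 ?addr0// => j ji.
  rewrite patchE Hi ifF//; apply: contraNF ji => /eqP ji.
  exact/eqP/val_inj.
rewrite Rintegral_sum//; last first.
  move=> j; have [jL2 _ _ _] := qjZ j.
  by apply: integrableS (in_L2_integrable jL2).
apply: eq_bigr => j _.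
transitivity (\int[mu]_(t in `[0, x]) (\sum_r c j r * psi j r t)).
  apply: Rintegral_ae_eq; apply: (ae_imply (ae_eq_itv_oo_cc (cE j))) => t + /sub.
  exact.
have iS r : mu.-integrable `[0, x] (EFin \o psi j r).
  by apply: integrableS (psi_integrable j r).
rewrite Rintegral_sum//; last by move=> r; exact: integrable_scaler.
by apply: eq_bigr => r _; rewrite RintegralZl// thetaE.
Qed.

(** The two summands are kept apart because they carry different levels: the primitive has level
    [m], the constant that normalizes the mean has level 0. For [m = 0] the primitive of a
    polynomial of degree at most k has degree at most k + 1. *)
Lemma antider_Z m q : Z_space k m q -> exists y1 y0,
  [/\ Y_space psi m y1, Y_space psi 0 y0 &
      forall x, 0 <= x <= 1 -> antider q x = y1 x + y0 x].
Proof.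
case: m => [|m] qZ; last first.
  exists (fun x => \int[mu]_(t in `[0, x]) q t).
  exists (cst (- \int[mu]_(y in `[0, 1]) \int[mu]_(t in `[0, y]) q t)).
  by split; [exact: Z_primitive|exact: Y0_cst|].
have [_ /(_ 0%N isT)[p sp]] := qZ; rewrite cell00 => qp.
have [P sP PE] := polynomial_primitive p.
exists (horner P).
exists (cst (- \int[mu]_(y in `[0, 1]) \int[mu]_(t in `[0, y]) p.[t])).
split; [|exact: Y0_cst|].
  by apply: Y0_horner; rewrite (leq_trans sP).
by move=> x x01; rewrite (antider_ae_eq x01 qp)/= -PE//; case/andP: x01.
Qed.

End hierarchical_spaces.

(** * Sparse tensor product spaces *)

(** A finite family is treated as a countable one, with a vacuous condition at indices out of
    range. *)
Lemma ae_forall_ord d (T : measurableType d) (R : realType)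
    (mu : {measure set T -> \bar R}) N (P : 'I_N -> T -> Prop) :
  (forall i, {ae mu, forall x, P i x}) -> {ae mu, forall x, forall i, P i x}.
Proof.
move=> aeP; have : {ae mu, forall x, forall n (nN : (n < N)%N), P (Ordinal nN) x}.
  apply: ae_foralln => n; case: (pselect (n < N)%N) => nN.
    by apply: (ae_imply (aeP (Ordinal nN))) => x Px nN';
      rewrite (bool_irrelevance nN' nN).
  by apply: aeW.
move=> H; apply: (ae_imply H) => x Px i.
by have := Px _ (ltn_ord i); congr (P _ x); exact: val_inj.
Qed.

Definition update (I : eqType) (T : Type) (f : I -> T) (i : I) (a : T) : I -> T :=
  fun j => if j == i then a else f j.

Section sparse_components.
Context (R : realType) (d k : nat) (psi : wavelets R k) (n : nat).
Local Notation mu := (@lebesgue_measure R).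
Local Notation "f =ae g" := (f = g %[ae lebesgue_Rn R d in @unit_cube R d])
  (at level 70).
Implicit Types (I : {set 'I_d}) (e : 'I_d -> R -> R) (f g : Rn R d -> R).

Definition tprod e (x : Rn R d) : R := \prod_(i < d) e i (tnth x i).

Lemma tprod_update e i q (x : Rn R d) :
  tprod (update e i q) x = (\prod_(j < d | j != i) e j (tnth x j)) * q (tnth x i).
Proof.
rewrite /tprod (bigD1 i)//= /update eqxx mulrC; congr (_ * _).
by apply: eq_bigr => j /negbTE ->.
Qed.

Lemma tprod_set_coord e i (x : Rn R d) (t : R) :
  tprod e (set_coord x i t) = (\prod_(j < d | j != i) e j (tnth x j)) * e i t.
Proof.
rewrite /tprod (bigD1 i)//= tnth_mktuple eqxx mulrC; congr (_ * _).
by apply: eq_bigr => j /negbTE ji; rewrite tnth_mktuple ji.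
Qed.

Definition factor_space I (m : 'I_d -> nat) i : set (R -> R) :=
  if i \in I then Z_space k (m i) else Y_space psi (m i).

(** The condition that [V_space] imposes on the coefficient of dx_I when |I| is the degree of the
    form. *)
Definition component I : set (Rn R d -> R) := [set f |
  exists N (m : 'I_N -> 'I_d -> nat) (w : 'I_N -> Rn R d -> R),
    (forall s, sparse_index n (m s) /\ W_space psi I (m s) (w s)) /\
    f =ae (fun x => \sum_(s < N) w s x)].

Lemma component_ae I f g : f =ae g -> component I g -> component I f.
Proof.
move=> fg [N [m [w [mw gE]]]]; exists N, m, w; split => //.
by apply: (ae_imply2 fg gE) => x fx gx x01; rewrite fx// gx.
Qed.

Lemma component0 I : component I (cst 0).
Proof.
exists 0%N, (fun _ _ => 0%N), (fun _ => cst 0); split; first by case.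
by apply: aeW => x _; rewrite big_ord0.
Qed.

Lemma componentD I f g : component I f -> component I g ->
  component I (fun x => f x + g x).
Proof.
move=> [N [m [w [mw fE]]]] [N' [m' [w' [mw' gE]]]].
exists (N + N')%N.
exists (fun s => match fintype.split s with inl a => m a | inr b => m' b end).
exists (fun s => match fintype.split s with inl a => w a | inr b => w' b end).
split; first by move=> s; case: (fintype.split s).
apply: (ae_imply2 fE gE) => x fx gx x01; rewrite fx// gx// big_split_ord.
congr (_ + _); apply: eq_bigr => s _.
  by rewrite (unsplitK (inl s)).
by rewrite (unsplitK (inr s)).
Qed.

Lemma componentZ I (c : R) f : component I f -> component I (fun x => c * f x).
Proof.
move=> [N [m [w [mw fE]]]]; exists N, m, (fun s x => c * w s x); split.
  move=> s; have [ms [M [a [e [eE wE]]]]] := mw s; split => //.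
  exists M, (fun r => c * a r), e; split => //.
  apply: (ae_imply wE) => x wx x01; rewrite wx// mulr_sumr.
  by apply: eq_bigr => r _; rewrite mulrA.
by apply: (ae_imply fE) => x fx x01; rewrite fx// mulr_sumr.
Qed.

Lemma component_sum I (J : Type) (s : seq J) (F : J -> Rn R d -> R) :
  (forall j, component I (F j)) -> component I (fun x => \sum_(j <- s) F j x).
Proof.
move=> IF; elim: s => [|j s ih].
  under eq_fun do rewrite big_nil; exact: component0.
by under eq_fun do rewrite big_cons; exact: componentD.
Qed.

Lemma component_tprod I m e : sparse_index n m ->
  (forall i, factor_space I m i (e i)) -> component I (tprod e).
Proof.
move=> sm eE; exists 1%N, (fun=> m), (fun=> tprod e); split; last first.
  by apply: aeW => x _; rewrite big_ord1.
move=> _; split => //; exists 1%N, (fun=> 1), (fun=> e); split => //.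
by apply: aeW => x _; rewrite big_ord1 mul1r.
Qed.

(** Flattens the sum over levels of sums of pure tensors into one finite sum, on which a coordinate
    operator can act term by term. *)
Lemma component_expand I f : component I f ->
  exists (T : finType) (c : T -> R) (m : T -> 'I_d -> nat)
    (e : T -> 'I_d -> R -> R),
    (forall s, sparse_index n (m s) /\
      forall i, factor_space I (m s) i (e s i)) /\
    f =ae (fun x => \sum_s c s * tprod (e s) x).
Proof.
move=> [N [m [w [mw fE]]]].
have /choice[M] : forall s, exists M, exists (c : 'I_M -> R)
    (e : 'I_M -> 'I_d -> R -> R),
    (forall r i, factor_space I (m s) i (e r i)) /\
    w s =ae (fun x => \sum_(r < M) c r * tprod (e r) x).
  by move=> s; have [_] := mw s.
(* The types of [c s] and [e s] depend on the number [M s] already chosen, so these choices are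
   dependent. *)
move=> H1; have /all_sig[c H2] := fun s => cid (H1 s).
have /all_sig[e ceE] := fun s => cid (H2 s).
exists {s : 'I_N & 'I_(M s)}.
exists (fun p => c (tag p) (tagged p)), (fun p => m (tag p)).
exists (fun p => e (tag p) (tagged p)); split.
  move=> [s r]; have [ms _] := mw s; split => // i.
  by have [+ _] := ceE s; exact.
have wE : {ae lebesgue_Rn R d, forall x, forall s, unit_cube x ->
    w s x = \sum_(r < M s) c s r * tprod (e s r) x}.
  by apply: ae_forall_ord => s; have [] := ceE s.
apply: (ae_imply2 fE wE) => x fx wx x01; rewrite fx//.
under eq_bigr do rewrite wx//.
by rewrite sig_big_dep.
Qed.

Lemma sparse_update0 (m : 'I_d -> nat) i :
  sparse_index n m -> sparse_index n (update m i 0%N).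
Proof.
rewrite /sparse_index; apply: leq_trans; apply: leq_sum => j _.
by rewrite /update; case: ifP.
Qed.

(** * Coordinate operators on the sparse components *)

Hypothesis hpsi : forall (m : nat) (j : 'I_(2 ^ m)),
  orthonormal_basis (@ZK_space R k m j) (@psi m j).

Lemma factor_integrable I m i q : factor_space I m i q ->
  mu.-integrable `[0, 1] (EFin \o q).
Proof.
rewrite /factor_space; case: ifP => _; first exact: Z_integrable.
exact: Y_integrable.
Qed.

(** In a pure tensor, factor [i] is replaced by its mean. As [i] is not in [I], this slot expects an
    element of Y, and a constant fits there at level 0. *)
Lemma component_int I i f : i \notin I -> component I f ->
  component I (fun x => \int[mu]_(t in `[0, 1]) f (set_coord x i t)).
Proof.
move=> iI /component_expand[T [c [m [e [meE fE]]]]].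
apply: component_ae (int_coord_ae_eq i fE) _.
rewrite (_ : (fun x => _) = (fun x => \sum_s c s *
    tprod (update (e s) i (cst (\int[mu]_(t in `[0, 1]) e s i t))) x)).
  apply: component_sum => s; apply: componentZ.
  have [sm eE] := meE s; apply: (@component_tprod _ (update (m s) i 0%N)).
    exact: sparse_update0.
  move=> j; have := eE j; rewrite /factor_space /update; case: eqP => // ->.
  by rewrite (negbTE iI) => _; exact: Y0_cst.
apply/funext => x; under eq_Rintegral => t _.
  under eq_bigr do rewrite tprod_set_coord mulrA.
  over.
have eint s : mu.-integrable `[0, 1] (EFin \o e s i).
  by have [_ /(_ i)] := meE s; exact: factor_integrable.
rewrite Rintegral_sum//; last by move=> s; exact: integrable_scaler.
apply: eq_bigr => s _.
by rewrite RintegralZl// tprod_update mulrA.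
Qed.

(** Every pure tensor produces two, one with its old levels and one with level 0 in slot [i].
    Removing [i] from [I] changes the type of that slot from Z to Y, which is where [antider_Z]
    lands. *)
Lemma component_A I i f : i \in I -> component I f ->
  component (I :\ i) (A_ i f).
Proof.
move=> iI /component_expand[T [c [m [e [meE fE]]]]].
apply: component_ae (A_ae_eq i fE) _.
have /choice[y1] : forall s, exists y1 y0, [/\ Y_space psi (m s i) y1,
    Y_space psi 0 y0 &
    forall x, 0 <= x <= 1 -> antider (e s i) x = y1 x + y0 x].
  move=> s; have [_ /(_ i)] := meE s; rewrite /factor_space iI.
  exact: antider_Z.
move=> /choice[y0] yE.
apply: (@component_ae _ _ (fun x => \sum_s c s *
    (tprod (update (e s) i (y1 s)) x + tprod (update (e s) i (y0 s)) x))).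
  apply: aeW => x x01; rewrite /A_.
  have /andP[/ltW xi0 /ltW xi1] := x01 i.
  under [X in antider X]eq_fun => t.
    under eq_bigr do rewrite tprod_set_coord mulrA.
    over.
  rewrite antider_sum ?xi0//; last first.
    by move=> s; have [_ /(_ i)] := meE s; exact: factor_integrable.
  apply: eq_bigr => s _; have [_ _ ->] := yE s; last by rewrite xi0.
  by rewrite !tprod_update -mulrDr mulrA.
apply: component_sum => s; apply: componentZ.
have [sm eE] := meE s; have [y1Y y0Y _] := yE s.
apply: componentD.
  apply: (component_tprod sm) => j; have := eE j.
  by rewrite /factor_space /update !inE; case: eqP => // ->.
apply: (component_tprod (sparse_update0 i sm)) => j; have := eE j.
by rewrite /factor_space /update !inE; case: eqP => // ->.
Qed.

(** * The spaces of forms under the operators p_i, h_i and the homotopy *)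

Local Notation V := (@V_space R d k psi n).

Lemma V_spaceP l u : V l u <-> forall I,
  if #|I| == l then component I (u I) else u I =ae cst 0.
Proof. by []. Qed.

Lemma V_space_p l u i : V l u -> V l (p_ i u).
Proof.
move=> /V_spaceP uV; apply/V_spaceP => I; have := uV I; rewrite /p_.
have [iI|iI] := boolP (i \in I).
  by case: ifP => _ _; [exact: component0|exact: aeW].
case: ifP => _; first exact: component_int.
move=> /(int_coord_ae_eq i) H; apply: (ae_imply H) => x {}H x01; rewrite H//.
by rewrite Rintegral_cst// mul0r.
Qed.

Lemma V_space_P_lt l u i : V l u -> V l (P_lt i u).
Proof.
move=> uV; rewrite /P_lt; elim: [seq j <- _ | _] => //= j s ih.
exact: V_space_p.
Qed.

Lemma antider0 (x : R) : antider (cst 0) x = 0 :> R.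
Proof.
rewrite /antider Rintegral_cst// mul0r sub0r.
under eq_Rintegral do rewrite Rintegral_cst// mul0r.
by rewrite Rintegral_cst// mul0r oppr0.
Qed.

(** Removing [i] from [I] can give [J] only if [J] omits [i], and then [I] must be [i |: J]; the
    defining sum has at most one term. *)
Lemma h_E u i J (x : Rn R d) : h_ i u J x = if i \in J then 0 else
  (-1) ^+ #|[set j in i |: J | (j < i)%N]| * A_ i (u (i |: J)) x.
Proof.
rewrite /h_; case: ifPn => iJ.
  rewrite big_pred0// => I; apply/negbTE/negP => /andP[_ /eqP IJ].
  by move: iJ; rewrite -IJ finset.setD11.
rewrite (big_pred1 (i |: J))// => I; apply/andP/eqP => [[iI /eqP <-]|->].
  by rewrite finset.setD1K.
by rewrite finset.setU11 finset.setU1K.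
Qed.

Lemma V_space_h l u i : V l.+1 u -> V l (h_ i u).
Proof.
move=> /V_spaceP uV; apply/V_spaceP => J.
rewrite (_ : h_ i u J = fun x => if i \in J then 0 else
  (-1) ^+ #|[set j in i |: J | (j < i)%N]| * A_ i (u (i |: J)) x); last first.
  by apply/funext => x; rewrite h_E.
have [iJ|iJ] := boolP (i \in J).
  by case: ifP => _; [exact: component0|exact: aeW].
(* Adding [i] raises the cardinality by one, so coefficients of the right degree correspond to each
   other, and so do those that vanish almost everywhere. *)
have := uV (i |: J); rewrite cardsU1 iJ add1n eqSS; case: ifP => _.
  move=> /(component_A (finset.setU11 i J)); rewrite finset.setU1K//.
  exact: componentZ.
move=> /(A_ae_eq i) H; apply: (ae_imply H) => x {}H x01; rewrite H//.
by rewrite /A_ antider0 mulr0.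
Qed.

Lemma V_space_homotopy l u : V l.+1 u -> V l (homotopy u).
Proof.
move=> uV; have PhV i : V l (P_lt i (h_ i u)).
  exact/V_space_P_lt/V_space_h.
apply/V_spaceP => J; rewrite /homotopy; case: ifPn => Jl.
  apply: component_sum => i; have /V_spaceP/(_ J) := PhV i.
  by rewrite Jl.
have aeP : {ae lebesgue_Rn R d, forall x, forall i : 'I_d, unit_cube x ->
    P_lt i (h_ i u) J x = 0}.
  apply: ae_forall_ord => i; have /V_spaceP/(_ J) := PhV i.
  by rewrite (negbTE Jl).
by apply: (ae_imply aeP) => x P0 x01; rewrite big1// => i _; exact: P0.
Qed.

End sparse_components.

Theorem lemma5p3 (R : realType) (d k n l : nat) (psi : wavelets R k)
    (hd : (1 <= d)%N)
    (hpsi : forall (m : nat) (j : 'I_(2 ^ m)),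
      orthonormal_basis (@ZK_space R k m j) (psi m j))
    (hl : (1 <= l <= d)%N) :
  @homotopy R d @` V_space psi n l `<=` V_space psi n (l - 1)%N.
Proof.
(* The bound 1 <= l excludes 0, so the truncated subtraction is a true predecessor. *)
case: l hl => [//|l] _ _ [u uV <-]; rewrite subn1.
exact: V_space_homotopy.
Qed.
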